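(* Let $\psi:\mathcal{P}\to\mathrm{Qsym}[t_1,t_2,\dots][\alpha]$ be a linear map (homomorphism of abelian groups), and write $\psi(\alpha,t_1,t_2,\dots)(p)$ for $\psi(p)$. Suppose that 1. $\psi(\alpha,0,0,\dots)(P^n)=\alpha^n$ for every $n$-dimensional polytope $P^n$ (all $n\ge 0$); 2. $T\circ\psi=\psi\circ\Phi$ as maps $\mathcal{P}\to\mathrm{Qsym}[t,t_1,t_2,\dots][\alpha]$, where on $\mathcal{P}[t]$ the map $\psi$ is extended by $\psi(t)=t$; that is, for every $p\in\mathcal{P}$, $$\psi(\alpha,t,t_1,t_2,\dots)(p)=\sum_{k\geqslant 0}\psi(\alpha,t_1,t_2,\dots)(d_kp)\,t^k .$$ Then $\psi=f$.
   Context: A combinatorial polytope is a combinatorial equivalence class of convex polytopes. The ring of polytopes $\mathcal{P}$ is, as an abelian group, free on all (non-empty) combinatorial polytopes, with multiplication the direct product and unit the point. The operator $d_k$ sends an $n$-dimensional polytope to the sum of all its $(n-k)$-dimensional (non-empty) faces ($d_0=\mathrm{id}$), and $\Phi:\mathcal{P}\to\mathcal{P}[t]$ is $\Phi(t)=\sum_{k\ge0}d_kt^k$. For a composition $\omega=(j_1,\dots,j_k)$, $j_i\ge 1$, $M_\omega=\sum_{l_1<\dots<l_k}t_{l_1}^{j_1}\cdots t_{l_k}^{j_k}$; $\mathrm{Qsym}[t_1,t_2,\dots]$ is the ring of finite integer combinations of the $M_\omega$ (and constants). $T:\mathrm{Qsym}[t_1,t_2,\dots][\alpha]\to\mathrm{Qsym}[t,t_1,t_2,\dots][\alpha]$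 is the ring homomorphism $Tg(\alpha,t_1,t_2,\dots)=g(\alpha,t,t_1,t_2,\dots)$ (the ordered variables $t_1,t_2,t_3,\dots$ are replaced by $t,t_1,t_2,\dots$). The generalized $f$-polynomial $f:\mathcal{P}\to\mathrm{Qsym}[t_1,t_2,\dots][\alpha]$ is the linear map $$f(\alpha,t_1,t_2,\dots)(P^n)=\alpha^n+\sum_{k=1}^{n}\ \sum_{0\leqslant a_1<\dots<a_k\leqslant n-1}f_{a_1,\dots,a_k}\,\alpha^{a_1}M_{(n-a_k,\,a_k-a_{k-1},\dots,\,a_2-a_1)},$$ where $f_{a_1,\dots,a_k}$ is the number of chains of faces $F^{a_1}\subset\dots\subset F^{a_k}$ of $P^n$ with $\dim F^{a_i}=a_i$. *)

(* Defs.v *)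
(* MathComp / MathComp-Analysis, with monalg from the multinomials library.    *)
From HB Require Import structures.
From mathcomp Require Import all_boot all_order all_algebra.
From mathcomp Require Import finmap.
From mathcomp Require Import boolp classical_sets functions cardinality fsbigop.
From mathcomp Require Import reals.
From mathcomp Require Import generic_quotient monalg.

Set Implicit Arguments.
Unset Strict Implicit.
Unset Printing Implicit Defensive.

Import Order.TTheory GRing.Theory Num.Theory.

Local Open Scope classical_set_scope.
Local Open Scope ring_scope.

(** * Convex polytopes *)

Section Polytopes.
Variable R : realType.

(* The points are the rows of V; there is at least one of them. *)
Definition conv_rows m k (V : 'M[R]_(k, m)) : set 'rV[R]_m :=
  [set x | exists w : 'rV[R]_k,
     [/\ forall i, 0 <= w 0 i, \sum_i w 0 i = 1 & x = w *m V]].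

Definition is_polytope m (A : set 'rV[R]_m) : Prop :=
  exists k (V : 'M[R]_(k.+1, m)), A = conv_rows V.

Record polytope m := Polytope {
  body :> set 'rV[R]_m;
  bodyP : `[< is_polytope body >] }.

HB.instance Definition _ m := [isSub for @body m].
HB.instance Definition _ m := [Choice of polytope m by <:].

(* Affine dimension: the largest k such that A contains k + 1 affinely
   independent points x, x + v_1, ..., x + v_k. *)
Definition affdim m (A : set 'rV[R]_m) : nat :=
  \max_(k < m.+1 | `[< exists (x : 'rV[R]_m) (V : 'M[R]_(k, m)),
                        [/\ A x, forall i, A (x + row i V) & row_free V] >]) k.

(* Nonempty faces, P itself included (c = 0, b = 0).  Polytopes are nonempty by
   definition, which excludes the empty face. *)
Definition faces m (P : polytope m) : set (polytope m) :=
  [set F | exists (c : 'cV[R]_m) (b : R),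
     (forall x, body P x -> (x *m c) 0 0 <= b) /\
     body F = body P `&` [set x | (x *m c) 0 0 = b]].

(** * Combinatorial polytopes *)

Definition any_polytope : Type := {m : nat & polytope m}.
HB.instance Definition _ := Choice.on any_polytope.

Definition comb_equiv_prop (P Q : any_polytope) : Prop :=
  exists phi : polytope (tag P) -> polytope (tag Q),
    set_bij (faces (tagged P)) (faces (tagged Q)) phi /\
    {in faces (tagged P) &, forall F G,
        body F `<=` body G <-> body (phi F) `<=` body (phi G)}.

Definition comb_equiv : rel any_polytope :=
  fun P Q => `[< comb_equiv_prop P Q >].

Lemma comb_equiv_refl : reflexive comb_equiv.
Proof.
move=> P; apply/asboolP; exists id; split=> //.
by split=> // y yP; exists y.
Qed.

Lemma comb_equiv_sym : symmetric comb_equiv.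
Proof.
suff H P Q : comb_equiv_prop P Q -> comb_equiv_prop Q P.
  by move=> P Q; apply/asboolP/asboolP; apply: H.
case=> phi [[phiF phiI phiS] phile].
have /choice[psi psiP] : forall G : polytope (tag Q), exists F,
    faces (tagged Q) G -> faces (tagged P) F /\ phi F = G.
  move=> G; have [/phiS[F PF <-]|nG] := pselect (faces (tagged Q) G).
    by exists F.
  by exists (tagged P).
exists psi; split; first split.
- by move=> G /psiP[].
- move=> G H /set_mem/psiP[_ eG] /set_mem/psiP[_ eH] e.
  by rewrite -eG -eH e.
- move=> F PF; exists (phi F); first exact: phiF.
  have [P' e] := psiP _ (phiF _ PF).
  by apply: phiI; rewrite ?inE.
- move=> G H /set_mem/psiP[PG eG] /set_mem/psiP[PH eH].
  rewrite -{1}eG -{1}eH; split=> h.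
    by apply/(phile _ _ _ _).2; rewrite ?inE.
  by apply/(phile _ _ _ _).1; rewrite ?inE.
Qed.

Lemma comb_equiv_trans : transitive comb_equiv.
Proof.
move=> Q P S /asboolP[phi [bphi lephi]] /asboolP[psi [bpsi lepsi]].
apply/asboolP; exists (psi \o phi); split; first exact: set_bij_comp bphi bpsi.
have phiF F : F \in faces (tagged P) -> phi F \in faces (tagged Q).
  by move=> /set_mem FP; apply/mem_set; case: bphi => + _ _; apply.
move=> F G FP GP /=.
exact: iff_trans (lephi _ _ FP GP) (lepsi _ _ (phiF _ FP) (phiF _ GP)).
Qed.

Canonical comb_equiv_rel :=
  EquivRel comb_equiv comb_equiv_refl comb_equiv_sym comb_equiv_trans.

Definition cpolytope : Type := {eq_quot comb_equiv}%qT.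
HB.instance Definition _ := Quotient.on cpolytope.
HB.instance Definition _ := Choice.on cpolytope.

Definition cclass m (P : polytope m) : cpolytope :=
  (\pi_cpolytope (Tagged polytope P))%qT.

(* The additive group of the ring of polytopes: integer combinations of
   combinatorial polytopes. *)
Definition Pgroup := {malg int[cpolytope]}.
HB.instance Definition _ := GRing.Zmodule.on Pgroup.
Definition Pgen (c : cpolytope) : Pgroup := << c >>.

Definition lin_ext (M : zmodType) (h : cpolytope -> M) (p : Pgroup) : M :=
  \sum_(c <- msupp p) h c *~ p@_c.

(** * The operators d_k *)

Definition d_polytope (k : nat) m (P : polytope m) : Pgroup :=
  \sum_(F \in [set F | faces P F /\ (affdim F + k = affdim P)%N])
     Pgen (cclass F).

(* Combinatorially equivalent polytopes have combinatorially equivalent faces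
   in each dimension, so the representative is immaterial. *)
Definition d (k : nat) : Pgroup -> Pgroup :=
  lin_ext (fun c => d_polytope k (tagged (repr c))).

End Polytopes.

(** * Quasi-symmetric functions *)

(* Formal power series in variables indexed by I with coefficients in Z[alpha],
   alpha being the variable 'X of {poly int}.  Only the module structure is
   used. *)
Definition series (I : choiceType) : Type := {cmonom I} -> {poly int}^o.
HB.instance Definition _ (I : choiceType) := GRing.Lmodule.on (series I).

Definition monom (I : choiceType) (s : seq (I * nat)) : {cmonom I} :=
  \big[mmul/mone]_(x <- s) expcmn (ucm x.1) x.2.

(* The index i : nat stands for the variable t_(i+1).  The coefficient of a
   monomial in M_w is the number of increasing sequences l producing it. *)
Definition M (w : seq nat) : series nat := fun m =>
  \sum_(l \in [set l : seq nat |
      [/\ size l = size w, sorted ltn l & monom (zip l w) = m]]) (1 : {poly int}).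

Lemma M_nil m : M [::] m = (m == mone)%:R.
Proof.
rewrite /M; have [->|ne] := eqVneq m mone.
  rewrite (_ : [set l | _] = [set [::]]) ?fsbig_set1 //.
  apply/seteqP; split=> [[|x l] [] //|_ ->]; split=> //=.
  by rewrite /monom big_nil.
rewrite (_ : [set l | _] = set0) ?fsbig_set0 //.
apply/seteqP; split=> // -[|x l] [] //= _ _ e; case/eqP: ne.
by rewrite -e /monom big_nil.
Qed.

(* Qsym[t_1, t_2, ...][alpha]: finite combinations, with coefficients in
   Z[alpha], of the M_w for w a composition (parts >= 1, possibly empty). *)
Definition is_qsym (g : series nat) : Prop :=
  exists s : seq ({poly int} * seq nat),
    all (fun x => all (leq 1) x.2) s /\ g = \sum_(x <- s) x.1 *: M x.2.

Definition qsym_pred : {pred series nat} := fun g => `[< is_qsym g >].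

Lemma qsym_submod_closed : submod_closed qsym_pred.
Proof.
split; first by apply/asboolP; exists [::]; rewrite big_nil.
move=> a _ _ /asboolP[s1 [p1 ->]] /asboolP[s2 [p2 ->]]; apply/asboolP.
exists ([seq (a * x.1, x.2) | x <- s1] ++ s2); split.
  by rewrite all_cat all_map p2 andbT.
rewrite big_cat big_map scaler_sumr; congr (_ + _).
by apply: eq_bigr => x _; rewrite scalerA.
Qed.

HB.instance Definition _ :=
  GRing.isSubmodClosed.Build {poly int} (series nat) qsym_pred
    qsym_submod_closed.

Record qsym := Qsym { qsym_series :> series nat; _ : qsym_series \in qsym_pred }.
HB.instance Definition _ := [isSub for qsym_series].
HB.instance Definition _ := [Choice of qsym by <:].
HB.instance Definition _ := [SubChoice_isSubLmodule of qsym by <:].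

(* g(alpha, 0, 0, ...) is the constant term of g. *)
Definition at_zero (g : series nat) : {poly int} := g mone.

(* Series obtained by replacing each monomial m by mu m. *)
Definition map_monom (I J : choiceType) (mu : {cmonom I} -> {cmonom J})
    (g : series I) : series J :=
  fun m => \sum_(m' \in mu @^-1` [set m]) g m'.

Definition rename (I J : choiceType) (s : I -> J) (m : {cmonom I}) : {cmonom J} :=
  monom [seq (s i, m i) | i <- finsupp m].

(* In the ordered variables t, t_1, t_2, ..., None is t and Some i is t_(i+1). *)
Definition T (g : series nat) : series (option nat) :=
  map_monom (rename (fun i => if i is j.+1 then Some j else None)) g.

(* g(alpha, t_1, t_2, ...) * t ^ k *)
Definition mul_t (k : nat) (g : series nat) : series (option nat) :=
  map_monom (fun m => mmul (expcmn (ucm None) k) (rename Some m)) g.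

(** * The generalized f-polynomial *)

Section FPolynomial.
Variable R : realType.

Definition chains m (P : polytope R m) (a : seq nat) : set (seq (polytope R m)) :=
  [set C | [/\ forall F, F \in C -> faces P F,
               [seq affdim (body F) | F <- C] = a
             & sorted (fun F G : polytope R m => `[< body F `<=` body G >]) C]].

Definition flag_number m (P : polytope R m) (a : seq nat) : nat :=
  #|` fset_set (chains P a)|.

(* For a = [:: a_1; ...; a_k], the composition is
   (n - a_k, a_k - a_(k-1), ..., a_2 - a_1). *)
Definition f_composition (n : nat) (a : seq nat) : seq nat :=
  pairmap subn n (rev a).

(* M [::] = 1, so the first summand is alpha ^ n (M_nil). *)
Definition f_series m (P : polytope R m) : series nat :=
  let n := affdim (body P) in
  'X^n *: M [::] +
  \sum_(1 <= k < n.+1)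
    \sum_(a : k.-tuple 'I_n | sorted ltn (map val a))
      ((flag_number P (map val a))%:R * 'X^(head 0%N (map val a)))
        *: M (f_composition n (map val a)).

Lemma f_composition_gt0 n (a : seq nat) :
  sorted ltn a -> all (ltn^~ n) a -> all (leq 1) (f_composition n a).
Proof.
rewrite /f_composition => sa ha.
have: path gtn n (rev a).
  case/lastP: a sa ha => [//|a x]; rewrite rev_rcons /= all_rcons.
  move=> sa /andP[-> _] /=; have := sa; rewrite -rev_sorted rev_rcons /=.
  by [].
elim: (rev a) n {sa ha} => //= x s IH n /andP[xn /IH ->].
by rewrite subn_gt0 xn.
Qed.

Lemma f_series_qsym m (P : polytope R m) : f_series P \in qsym_pred.
Proof.
have MP (c : {poly int}) w : all (leq 1) w -> c *: M w \in qsym_pred.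
  move=> pw; apply/asboolP; exists [:: (c, w)].
  by rewrite big_seq1 /= pw.
apply: rpredD; first exact: MP.
apply: rpred_sum => k _; apply: rpred_sum => a sa; apply: MP.
apply: f_composition_gt0 => //.
by apply/allP => _ /mapP[i _ ->]; apply: ltn_ord.
Qed.

(* As for d, the choice of representative is immaterial. *)
Definition f : Pgroup R -> qsym :=
  lin_ext (fun c => Qsym (f_series_qsym (tagged (repr c)))).

End FPolynomial.

(* Main.v *)
(* Comparing the coefficients of t^j t_1^(w_1) t_2^(w_2) ... in condition 2
   gives, for A(P, w) the coefficient of t_1^(w_1) ... t_k^(w_k) in psi(P),
     A(P, (j, w)) = sum of A(F, w) over the faces F of P of codimension j,
   and condition 1 gives A(P, ()) = alpha^(dim P).  As a face of a face is a
   face, unrolling the recursion shows that A(P, w) is the number of flags of P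
   of successive codimensions w times alpha^(dim P - |w|), which is also the
   coefficient of M_w in f(P).  A quasi-symmetric function is determined by its
   coefficients at such monomials in initial variables. *)
Require Import Defs.
From mathcomp Require Import all_boot all_order all_algebra.
From mathcomp Require Import finmap zify.
From mathcomp Require Import boolp classical_sets functions cardinality fsbigop.
From mathcomp Require Import reals generic_quotient monalg.

Set Implicit Arguments.
Unset Strict Implicit.
Unset Printing Implicit Defensive.

Import Order.TTheory GRing.Theory Num.Theory.

Local Open Scope classical_set_scope.
Local Open Scope ring_scope.

(** * Faces of polytopes *)

Section Faces.
Variable R : realType.

Lemma polytope_eq m (P Q : polytope R m) : body P = body Q -> P = Q.
Proof. exact: val_inj. Qed.

Lemma face_sub m (P F : polytope R m) : faces P F -> body F `<=` body P.
Proof. by case=> c [b [_ ->]] x []. Qed.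

(** The hyperplane that cuts [G] out of [P] also supports [F], and meets it in [G]. *)
Lemma face_of_sub m (P F G : polytope R m) :
  faces P F -> faces P G -> body G `<=` body F -> faces F G.
Proof.
move=> PF [c [b [le_b defG]]] GF; exists c, b; split.
  by move=> x /(face_sub PF)/le_b.
apply/seteqP; split=> x.
  by move=> Gx; split; [exact: GF|move: Gx; rewrite defG => -[]].
by case=> /(face_sub PF) Px Hx; rewrite defG.
Qed.

Lemma slack_conv m k (V : 'M[R]_(k, m)) (w : 'rV[R]_k) (c : 'cV[R]_m) b :
  \sum_i w 0 i = 1 ->
  b - (w *m V *m c) 0 0 = \sum_i w 0 i * (b - (row i V *m c) 0 0).
Proof.
move=> w1; under eq_bigr do rewrite mulrBr.
rewrite sumrB -mulr_suml w1 mul1r -mulmxA mxE; congr (_ - _).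
by apply: eq_bigr => i _; rewrite -row_mul !mxE.
Qed.

Lemma row_conv_rows m k (V : 'M[R]_(k, m)) i : conv_rows V (row i V).
Proof.
exists (delta_mx 0 i); split; last by rewrite rowE.
  by move=> j; rewrite mxE ler0n.
rewrite (bigD1 i) //= mxE !eqxx big1 ?addr0 // => j /negbTE ji.
by rewrite mxE ji andbF.
Qed.

(* A convex combination of points on one side of a hyperplane lies on the
   hyperplane only if all points of positive weight do. *)
Lemma face_conv_support m k (V : 'M[R]_(k, m)) (P F : polytope R m)
    (w : 'rV[R]_k) :
  body P = conv_rows V -> faces P F ->
  (forall i, 0 <= w 0 i) -> \sum_i w 0 i = 1 ->
  body F (w *m V) <-> forall i, w 0 i != 0 -> body F (row i V).
Proof.
move=> defP [c [b [le_b ->]]] w_ge0 w1.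
have PV i : body P (row i V) by rewrite defP; exact: row_conv_rows.
have s_ge0 i : 0 <= w 0 i * (b - (row i V *m c) 0 0).
  by rewrite mulr_ge0 ?subr_ge0 ?le_b.
split=> [[_ /= eb] i wi|FV].
  split=> //=; apply/esym/eqP; rewrite -subr_eq0.
  have /eqP := slack_conv V c b w1; rewrite eb subrr eq_sym psumr_eq0 //.
  by move=> /allP/(_ i (mem_index_enum i))/=; rewrite mulf_eq0 (negbTE wi).
split; first by rewrite defP; exists w.
apply/esym/eqP; rewrite /= -subr_eq0 slack_conv // big1 // => i _.
have [->|/FV[_ /= ->]] := eqVneq (w 0 i) 0; first by rewrite mul0r.
by rewrite subrr mulr0.
Qed.

Lemma polytopeP m (P : polytope R m) :
  exists k (V : 'M[R]_(k.+1, m)), body P = conv_rows V.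
Proof. exact/asboolP/bodyP. Qed.

(** By [face_conv_support] a face is determined by the rows of [V] that it contains, and these form
    one of finitely many subsets. *)
Lemma finite_faces m (P : polytope R m) : finite_set (faces P).
Proof.
have [k [V defP]] := polytopeP P.
pose vertices (F : polytope R m) := [set i | `[< body F (row i V) >]]%SET.
suff vertices_inj : {in faces P &, injective vertices}.
  by rewrite -(eq_finite_set (inj_card_eq vertices_inj)); exact: finite_finset.
have sub F G : faces P F -> faces P G -> vertices F = vertices G ->
    body F `<=` body G.
  move=> PF PG eFG x Fx; move: (Fx).
  have := face_sub PF Fx; rewrite defP => -[w [w_ge0 w1 ->]].
  rewrite (face_conv_support defP PF) // (face_conv_support defP PG) // => h i /h.
  move=> Fi; have : i \in vertices F by rewrite inE; apply/asboolP.
  by rewrite eFG inE => /asboolP.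
move=> F G /set_mem PF /set_mem PG eFG; apply: polytope_eq.
by apply/seteqP; split; apply: sub.
Qed.

(* If [c x = b] cuts out F in P and [c' x = b'] cuts out G in F, then
   [(N c + c') x = N b + b'] cuts out G in P for N large enough. *)
Lemma faces_trans m (P F G : polytope R m) : faces P F -> faces F G -> faces P G.
Proof.
move=> PF FG; have [k [V defP]] := polytopeP P.
case: (PF) => c [b [le_b defF]]; case: FG => c' [b' [le_b' defG]].
pose s i := b - (row i V *m c) 0 0; pose s' i := b' - (row i V *m c') 0 0.
have PV i : body P (row i V) by rewrite defP; exact: row_conv_rows.
have s_ge0 i : 0 <= s i by rewrite subr_ge0 le_b.
have s'_ge0 i : s i = 0 -> 0 <= s' i.
  move/eqP; rewrite subr_eq0 => /eqP si; rewrite subr_ge0 le_b' // defF.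
  by split; rewrite //= si.
(* [N] exceeds every ratio |s' i| / s i, so the combined slack [N * s i + s' i] is positive at each
   row off [F]. Where [s i = 0] the quotient is 0 by convention. *)
pose N := 1 + \sum_i `|s' i| / s i.
have r_ge0 i : 0 <= `|s' i| / s i by rewrite divr_ge0.
have N_ge0 : 0 <= N by rewrite addr_ge0 // sumr_ge0.
have gt0 i : s i != 0 -> 0 < N * s i + s' i.
  move=> si; have si0 : 0 < s i by rewrite lt_def si s_ge0.
  have : `|s' i| / s i < N.
    rewrite /N (bigD1 i) //= addrCA ltrDl ltr_wpDr // sumr_ge0 //.
  rewrite ltr_pdivrMr // -subr_gt0 => /lt_le_trans; apply.
  by rewrite lerD2l lerNl -normrN ler_norm.
have ge0 i : 0 <= N * s i + s' i.
  have [si|/gt0/ltW//] := eqVneq (s i) 0.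
  by rewrite si mulr0 add0r s'_ge0.
have slackE x : N * b + b' - (x *m (N *: c + c')) 0 0 =
    N * (b - (x *m c) 0 0) + (b' - (x *m c') 0 0).
  by rewrite mulmxDr -scalemxAr !mxE mulrBr opprD addrACA.
have slackV i : N * b + b' - (row i V *m (N *: c + c')) 0 0 = N * s i + s' i.
  exact: slackE.
exists (N *: c + c'), (N * b + b'); split.
  move=> x; rewrite defP => -[w [w_ge0 w1 ->]].
  rewrite -subr_ge0 slack_conv // sumr_ge0 // => i _.
  by rewrite slackV mulr_ge0.
apply/seteqP; split=> x.
  rewrite defG => -[Fx /= eb']; split; first exact: face_sub PF _ Fx.
  move: Fx; rewrite defF => -[_ /= eb].
  by apply/esym/eqP; rewrite -subr_eq0 slackE eb eb' !subrr mulr0 addr0.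
case=> Px /= /esym/eqP; rewrite -subr_eq0; move: (Px); rewrite defP.
case=> w [w_ge0 w1 xE]; rewrite {1}xE slack_conv // psumr_eq0; last first.
  by move=> i _; rewrite slackV mulr_ge0.
move=> /allP w_eq0.
(* Nonnegative terms with sum zero all vanish, so each row of nonzero weight has combined slack 0
   and, by [gt0], lies in [F]. *)
have Fx : body F x.
  rewrite xE (face_conv_support defP PF) // => i wi; rewrite defF; split=> //=.
  apply/esym/eqP; rewrite -subr_eq0; apply/negPn/negP => /gt0.
  have := w_eq0 i (mem_index_enum i); rewrite slackV mulf_eq0 (negbTE wi).
  by move=> /eqP ->; rewrite ltxx.
rewrite defG; split=> //=.
move: (Fx); rewrite defF => -[_ /= eb].
have : N * b + b' - (x *m (N *: c + c')) 0 0 = 0.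
  rewrite {1}xE slack_conv // big1 // => i _; exact/eqP/w_eq0/mem_index_enum.
by rewrite slackE eb subrr mulr0 add0r => /eqP; rewrite subr_eq0 eq_sym => /eqP.
Qed.

End Faces.

(** * Coefficients of quasi-symmetric functions *)

Section Monomials.
Variable I : choiceType.

Lemma expcm_ucmE (j : I) k i : expcmn (ucm j) k i = ((j == i) * k)%N.
Proof.
case: k => [|k]; first by rewrite muln0 onecmE.
rewrite /expcmn iteropS; elim: k => [|k IH]; first by rewrite /= ucmE muln1.
by rewrite iterS mulcmE IH ucmE [RHS]mulnS.
Qed.

Lemma monomE (s : seq (I * nat)) i :
  monom s i = (\sum_(x <- s) (x.1 == i) * x.2)%N.
Proof.
rewrite /monom; elim: s => [|x s IH]; first by rewrite !big_nil cm1.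
by rewrite !big_cons cmM IH expcm_ucmE.
Qed.

(** For [i] outside [l], [index i l] is [size w], where [nth] returns its default 0, the correct
    exponent. *)
Lemma monom_zip (l : seq I) (w : seq nat) i :
  uniq l -> size l = size w -> monom (zip l w) i = nth 0%N w (index i l).
Proof.
rewrite monomE; elim: l w => [|j l IH] [|k w] //=; first by rewrite big_nil.
move=> /andP[jl ul] [sz]; rewrite big_cons IH //=.
case: eqVneq jl => [->|_ _]; last by rewrite mul0n.
rewrite -index_mem -leqNgt sz => ?.
by rewrite [nth 0%N w _]nth_default //= mul1n addn0.
Qed.

Lemma monom_zip_gt0 (l : seq I) (w : seq nat) i :
  uniq l -> size l = size w -> all (leq 1) w -> (0 < monom (zip l w) i)%N = (i \in l).
Proof.
move=> ul sz w_gt0; rewrite monom_zip // -index_mem sz.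
have [iw|wi] := ltnP (index i l) (size w); last by rewrite nth_default.
exact/(allP w_gt0)/mem_nth.
Qed.

Lemma monom_zip_inj (l : seq I) (u w : seq nat) :
  uniq l -> size l = size u -> size l = size w ->
  monom (zip l u) = monom (zip l w) -> u = w.
Proof.
move=> ul lu lw e; apply: (@eq_from_nth _ 0%N); first by rewrite -lu.
case: l lu lw ul e => [<- //|i0 l] lu lw ul e i; rewrite -lu => il.
have := congr1 (fun m : {cmonom I} => m (nth i0 (i0 :: l) i)) e.
by rewrite !monom_zip // index_uniq.
Qed.

Lemma monom_support (m : {cmonom I}) (l : seq I) :
  uniq l -> l =i finsupp m -> monom (zip l (map m l)) = m.
Proof.
move=> ul lm; apply/eqP/cmP => i; rewrite monom_zip ?size_map //.
have [il|il] := boolP (i \in l).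
  by rewrite (nth_map i) ?index_mem // nth_index.
rewrite nth_default; last by rewrite size_map leqNgt index_mem.
by apply/esym/eqP; rewrite cmE_eq0 -lm.
Qed.

End Monomials.

(** * Changes of variables on monomials and on series *)

Section Rename.
Variables (I J : choiceType) (s : I -> J).

Lemma rename_notin (m : {cmonom I}) j : (forall i, s i != j) -> rename s m j = 0%N.
Proof.
move=> sj; rewrite monomE big_map big1 // => i _ /=.
by rewrite (negbTE (sj i)).
Qed.

Hypothesis s_inj : injective s.

Lemma renameE (m : {cmonom I}) i : rename s m (s i) = m i.
Proof.
rewrite monomE big_map /=.
have [iin|iout] := boolP (i \in finsupp m).
  rewrite (big_rem i) //= eqxx mul1n big_seq big1 ?addn0 // => i'.
  rewrite mem_rem_uniq ?fset_uniq // !inE => /andP[/negbTE ne _].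
  by rewrite (inj_eq s_inj) ne.
move: (iout); rewrite -cmE_eq0 => /eqP ->; rewrite big_seq big1 // => i' i'm.
by rewrite (inj_eq s_inj); case: eqVneq iout i'm => // -> /negP.
Qed.

Lemma rename_inj : injective (rename s).
Proof. by move=> m m' e; apply/eqP/cmP => i; rewrite -!renameE e. Qed.

End Rename.

Section MapMonom.
Variables (I J : choiceType) (mu : {cmonom I} -> {cmonom J}).

Lemma map_monom_inj (g : series I) m : injective mu -> map_monom mu g (mu m) = g m.
Proof.
move=> mu_inj; rewrite /map_monom (_ : _ @^-1` _ = [set m]) ?fsbig_set1 //.
by apply/seteqP; split=> [m' /mu_inj|m' ->].
Qed.

Lemma map_monom_notin (g : series I) m : (forall m', mu m' <> m) -> map_monom mu g m = 0.
Proof.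
move=> mu_m; rewrite /map_monom (_ : _ @^-1` _ = set0) ?fsbig_set0 //.
by apply/seteqP; split=> [m' /mu_m|].
Qed.

Lemma map_monom0 : map_monom mu (0 : series I) = 0.
Proof. by apply/funext => m; rewrite /map_monom fsbig1. Qed.

End MapMonom.

Lemma sum_seriesE (I : choiceType) (A : Type) (r : seq A) (P : pred A)
    (F : A -> series I) m :
  (\sum_(a <- r | P a) F a) m = \sum_(a <- r | P a) F a m.
Proof. exact: (big_morph (fun g : series I => g m)). Qed.

(** The monomial in initial variables at which all coefficients are compared. *)
Definition compact_monom (w : seq nat) : {cmonom nat} :=
  monom (zip (iota 0 (size w)) w).

Lemma compact_monomE w i : compact_monom w i = nth 0%N w i.
Proof.
rewrite monom_zip ?iota_uniq ?size_iota //.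
have [iw|wi] := ltnP i (size w).
  by rewrite -{1}[i](nth_iota 0 0 iw) ?index_uniq ?iota_uniq ?size_iota.
by rewrite !nth_default // leqNgt -[X in (_ < X)%N](size_iota 0) index_mem mem_iota -leqNgt.
Qed.

(** The body repeats the monomial map of [mul_t], so [mul_t k] is [map_monom (cons_monom k)] by
    conversion. *)
Definition cons_monom (k : nat) (m : {cmonom nat}) : {cmonom option nat} :=
  mmul (expcmn (ucm None) k) (rename Some m).

Lemma cons_monom_None k m : cons_monom k m None = k.
Proof. by rewrite cmM expcm_ucmE eqxx mul1n rename_notin ?addn0. Qed.

Lemma cons_monom_Some k m i : cons_monom k m (Some i) = m i.
Proof. by rewrite cmM expcm_ucmE mul0n renameE // => ? ? []. Qed.

(** The renaming behind [T] sends index 0 to [None] and shifts the others down, so the first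
    exponent becomes the exponent of t. *)
Lemma T_cons_monom (g : series nat) k w :
  T g (cons_monom k (compact_monom w)) = g (compact_monom (k :: w)).
Proof.
pose s i := if i is j.+1 then Some j else None.
have s_inj : injective s by move=> [|i] [|j] //= [->].
rewrite /T -(map_monom_inj g (compact_monom (k :: w)) (rename_inj s_inj)).
congr (_ _); apply/eqP/cmP => -[i|].
  by rewrite cons_monom_Some (renameE s_inj _ i.+1) !compact_monomE.
by rewrite cons_monom_None (renameE s_inj _ 0) compact_monomE.
Qed.

Lemma mul_t_cons_monom (g : series nat) j k m :
  mul_t j g (cons_monom k m) = if j == k then g m else 0.
Proof.
case: eqVneq => [->|ne].
  rewrite /mul_t [LHS](map_monom_inj (mu := cons_monom k)) // => m1 m2 e.
  by apply/eqP/cmP => i; rewrite -!(cons_monom_Some k) e.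
apply: map_monom_notin => m' e; move/eqP: ne; apply.
by rewrite -(cons_monom_None j m') -(cons_monom_None k m) -e.
Qed.

(** Since all parts are positive, the support of the monomial recovers [l], and its exponents then
    recover [u]; at most one sequence contributes to the coefficient. *)
Lemma M_monom_zip (l u w : seq nat) :
  sorted ltn l -> size l = size w -> all (leq 1) u -> all (leq 1) w ->
  M u (monom (zip l w)) = (u == w)%:R.
Proof.
move=> sl lw u_gt0 w_gt0; have ul := sorted_uniq ltn_trans ltnn sl.
have setE l' : [/\ size l' = size u, sorted ltn l' &
    monom (zip l' u) = monom (zip l w)] -> l' = l /\ u = w.
  case=> l'u sl' e; have ul' := sorted_uniq ltn_trans ltnn sl'.
  have l'E : l' = l.
    apply: (irr_sorted_eq ltn_trans ltnn) => // i.
    by rewrite -(monom_zip_gt0 i ul' l'u) // e monom_zip_gt0.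
  by subst l'; split=> //; exact: monom_zip_inj e.
rewrite /M; case: eqVneq => [uw|ne].
  subst w; rewrite (_ : [set l | _] = [set l]) ?fsbig_set1 //.
  by apply/seteqP; split=> [l' /setE[]|_ ->].
rewrite (_ : [set l | _] = set0) ?fsbig_set0 //.
apply/seteqP; split=> // l' /setE[_ e]; by rewrite e eqxx in ne.
Qed.

(** Quasi-symmetry: in each [M u] the coefficient depends only on the exponents [w], not on the
    increasing indices [l]. *)
Lemma qsym_compact (g : qsym) (l w : seq nat) :
  sorted ltn l -> size l = size w -> all (leq 1) w ->
  qsym_series g (monom (zip l w)) = qsym_series g (compact_monom w).
Proof.
case: g => g /= /asboolP[s [/allP s_gt0 ->]] sl lw w_gt0.
rewrite !sum_seriesE !big_seq; apply: eq_bigr => x /s_gt0 x_gt0.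
rewrite /GRing.scale /=; congr (_ * _).
by rewrite !M_monom_zip ?iota_ltn_sorted ?size_iota.
Qed.

(** Sorting the support of an arbitrary monomial puts it in the form required by [qsym_compact]. *)
Lemma qsym_eq (g h : qsym) :
  (forall w, all (leq 1) w ->
     qsym_series g (compact_monom w) = qsym_series h (compact_monom w)) ->
  g = h.
Proof.
move=> gh; apply/val_inj/funext => m.
pose l := sort leq (finsupp m).
have ul : uniq l by rewrite sort_uniq fset_uniq.
have sl : sorted ltn l by rewrite ltn_sorted_uniq_leq ul sort_sorted //; exact: leq_total.
have lm : l =i finsupp m by move=> i; rewrite mem_sort.
have w_gt0 : all (leq 1) (map m l).
  by apply/allP => _ /mapP[i + ->]; rewrite lm -cmE_neq0 lt0n.
rewrite -(monom_support ul lm).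
by have := gh _ w_gt0; rewrite -!(qsym_compact _ sl) ?size_map.
Qed.

(** * Flags *)

Section Flags.
Variable R : realType.

(** The last face [F] of a chain contains all the others. These are faces of [F] by [face_of_sub],
    and conversely faces of [F] are faces of [P] by [faces_trans]. *)
Lemma chains_rcons m (P : polytope R m) b e :
  chains P (rcons b e) =
  \bigcup_(F in [set F | faces P F /\ affdim (body F) = e])
    ((rcons^~ F) @` chains F b).
Proof.
have tr : transitive (fun F G : polytope R m => `[< body F `<=` body G >]).
  move=> F G H /asboolP GF /asboolP FH; apply/asboolP.
  exact: subset_trans GF FH.
apply/seteqP; split=> C.
  case; case/lastP: C => [|C F]; first by case: b.
  rewrite map_rcons => PC /rcons_inj[dimC dimF].
  rewrite sorted_pairwise // pairwise_rcons -sorted_pairwise // => /andP[CF sC].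
  have PF : faces P F by apply: PC; rewrite mem_rcons mem_head.
  exists F => //; exists C => //; split=> // G GC.
  apply: (face_of_sub PF); first by apply: PC; rewrite mem_rcons in_cons GC orbT.
  exact/asboolP/(allP CF).
case=> F [PF dimF] [{}C [FC dimC sC] <-]; split.
- move=> G; rewrite mem_rcons in_cons => /predU1P[->//|/FC]; exact: faces_trans.
- by rewrite map_rcons dimC dimF.
- rewrite sorted_pairwise // pairwise_rcons -sorted_pairwise // sC andbT.
  by apply/allP => G /FC /face_sub GF; apply/asboolP.
Qed.

Lemma chains_nil m (P : polytope R m) : chains P [::] = [set [::]].
Proof. by apply/seteqP; split=> [[|F C] []|_ ->]. Qed.

Lemma finite_faces_dim m (P : polytope R m) (p : nat -> Prop) :
  finite_set [set F | faces P F /\ p (affdim (body F))].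
Proof. by apply: sub_finite_set (finite_faces P) => F []. Qed.

Lemma finite_chains m (P : polytope R m) a : finite_set (chains P a).
Proof.
elim/last_ind: a P => [|b e IH] P; first by rewrite chains_nil.
rewrite chains_rcons; apply: bigcup_finite.
  exact: (finite_faces_dim P (fun i => i = e)).
by move=> F _; apply: finite_image.
Qed.

Lemma flag_number_nil m (P : polytope R m) : flag_number P [::] = 1%N.
Proof. by rewrite /flag_number chains_nil fset_set1 cardfs1. Qed.

Lemma flag_number_rcons m (P : polytope R m) b e :
  flag_number P (rcons b e) =
  (\sum_(F <- fset_set [set F | faces P F /\ affdim (body F) = e])
     flag_number F b)%N.
Proof.
rewrite /flag_number; set X := fset_set (chains P _); set Y := fset_set _.
have finY := finite_faces_dim P (fun i => i = e).
have XP C : C \in X = `[< chains P (rcons b e) C >].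
  by rewrite in_fset_set; last exact: finite_chains.
(* Double counting: a chain is counted once, through its last face. The default [P] of [last] never
   arises, as the chains in [X] are nonempty. *)
transitivity (\sum_(C <- X) \sum_(F <- Y) (last P C == F))%N.
  rewrite -[LHS]sum1_size big_seq [RHS]big_seq; apply: eq_bigr => C.
  rewrite XP chains_rcons => /asboolP[F FY [C' _ <-]]; rewrite last_rcons.
  have {}FY : F \in Y by rewrite in_fset_set // inE.
  rewrite (bigD1_seq F) ?fset_uniq //= eqxx big1 // => G.
  by rewrite eq_sym => /negbTE ->.
rewrite exchange_big big_seq [RHS]big_seq; apply: eq_bigr => F.
rewrite in_fset_set // => /set_mem FY.
(* The chains in [X] ending in [F] are those of [chains F b] with [F] appended. *)
rewrite -big_mkcond /= sum1_count -size_filter.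
rewrite -(size_map (rcons^~ F) (fset_set (chains F b))); apply/perm_size/uniq_perm.
- by rewrite filter_uniq ?fset_uniq.
- by rewrite map_inj_uniq ?fset_uniq // => C C' /rcons_inj[].
move=> C; rewrite mem_filter XP chains_rcons.
apply/andP/mapP => [[/eqP lC /asboolP[G _ [C' GC' eC]]]|[C' + ->]].
  move: lC; rewrite -eC last_rcons => <-; exists C' => //.
  by rewrite in_fset_set ?inE //; exact: finite_chains.
rewrite in_fset_set; last exact: finite_chains.
move=> /set_mem FC'; rewrite last_rcons eqxx; split=> //.
by apply/asboolP; exists F => //; exists C'.
Qed.

End Flags.

(* For a composition w = (j_1, ..., j_k) of at most n, the dimensions
   n - j_1 - ... - j_k < ... < n - j_1 of the flags counted by the coefficient
   of M_w in f_series; it inverts f_composition. *)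
Definition flag_dims (n : nat) (w : seq nat) : seq nat := rev (scanl subn n w).

Lemma flag_dims_cons n k w :
  flag_dims n (k :: w) = rcons (flag_dims (n - k)%N w) (n - k)%N.
Proof. by rewrite /flag_dims /= rev_cons. Qed.

Lemma f_composition_rcons n b e :
  f_composition n (rcons b e) = (n - e)%N :: f_composition e b.
Proof. by rewrite /f_composition rev_rcons. Qed.

(** The bound on [sumn w] keeps every truncated subtraction exact. *)
Lemma flag_dimsK n w : (sumn w <= n)%N -> f_composition n (flag_dims n w) = w.
Proof.
elim: w n => //= k w IH n le_n; rewrite flag_dims_cons f_composition_rcons.
by rewrite subKn ?IH //; [lia|exact: leq_trans (leq_addr _ _) le_n].
Qed.

(** For nonempty [a] the parts telescope to [n] minus the least entry, whence the bound. *)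
Lemma f_compositionK n a : sorted ltn a -> all (ltn^~ n) a ->
  (sumn (f_composition n a) <= n)%N /\ flag_dims n (f_composition n a) = a.
Proof.
elim/last_ind: a n => // b e IH n; rewrite all_rcons => sa /andP[/= en _].
have [sb be] : sorted ltn b /\ all (ltn^~ e) b.
  move: sa; rewrite !(sorted_pairwise ltn_trans) pairwise_rcons.
  by case/andP.
have [le_e eb] := IH e sb be.
rewrite f_composition_rcons flag_dims_cons /= subKn ?eb ?(ltnW en) //.
by split=> //; lia.
Qed.

Lemma flag_dims_sorted n w : all (leq 1) w -> (sumn w <= n)%N ->
  sorted ltn (flag_dims n w) /\ all (ltn^~ n) (flag_dims n w).
Proof.
elim: w n => //= k w IH n /andP[k_gt0 w_gt0] le_n.
have [||sw wn] := IH (n - k)%N => //; first by lia.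
rewrite flag_dims_cons (sorted_pairwise ltn_trans) pairwise_rcons wn.
rewrite -(sorted_pairwise ltn_trans) sw all_rcons; split=> //.
apply/andP; split; first by lia.
by apply: sub_all wn => i; rewrite /=; lia.
Qed.

(** Identifies the exponent of alpha in [f_series]. For empty [w] the default 0 of [head] would
    differ from [n]. *)
Lemma head_flag_dims n w : w != [::] -> (sumn w <= n)%N ->
  head 0%N (flag_dims n w) = (n - sumn w)%N.
Proof.
elim: w n => // k [|j w] IH n _ /= le_n; first by rewrite addn0.
rewrite flag_dims_cons; have := IH (n - k)%N isT.
by rewrite /flag_dims [scanl _ _ _]/= rev_cons; case: (rev _) => /= [|? ?] ->; lia.
Qed.

Lemma ord_seq n a : all (ltn^~ n) a -> exists s : seq 'I_n, map val s = a.
Proof.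
elim: a => [|i a IH] /=; first by exists [::].
by case/andP=> ilt /IH[s <-]; exists (Ordinal ilt :: s).
Qed.

(** * Coefficients of the generalized f-polynomial *)

Section FSeriesCoefficient.
Variables (R : realType) (m : nat) (P : polytope R m).

(** As [f_composition] and [flag_dims] are mutually inverse, a nonempty [w] is produced only by the
    sequence [flag_dims n w], and by none if its sum exceeds [n]. *)
Lemma f_series_compact w : all (leq 1) w ->
  f_series P (compact_monom w) =
  if (sumn w <= affdim (body P))%N
  then (flag_number P (flag_dims (affdim (body P)) w))%:R *
       'X^(affdim (body P) - sumn w)
  else 0.
Proof.
move=> w_gt0; rewrite /f_series; set n := affdim _.
have M_compact u : all (leq 1) u -> M u (compact_monom w) = (u == w)%:R.
  by move=> u_gt0; rewrite M_monom_zip ?iota_ltn_sorted ?size_iota.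
have M_comp k (a : k.-tuple 'I_n) : sorted ltn (map val a) ->
    M (f_composition n (map val a)) (compact_monom w) =
    (f_composition n (map val a) == w)%:R.
  move=> sa; rewrite M_compact // f_composition_gt0 //.
  by apply/allP => _ /mapP[i _ ->]; exact: ltn_ord.
have size_comp a : size (f_composition n a) = size a.
  by rewrite /f_composition size_pairmap size_rev.
have addE (g h : series nat) x : (g + h) x = g x + h x by [].
have scaleE (c : {poly int}) (g : series nat) x : (c *: g) x = c * g x by [].
rewrite addE scaleE sum_seriesE.
under eq_bigr => k _.
  rewrite sum_seriesE; under eq_bigr => a sa do rewrite scaleE M_comp //.
  over.
rewrite M_compact //.
(* The empty composition comes from the leading summand alone, every other one having [k > 0]
   parts. *)
have [w0|w_neq0] := eqVneq w [::].
  rewrite w0 mulr1 leq0n subn0 flag_number_nil mul1r.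
  rewrite big_nat big1 ?addr0 // => k /andP[k_gt0 _]; rewrite big1 // => a _.
  rewrite -size_eq0 size_comp size_map size_tuple.
  by rewrite gtn_eqF ?mulr0.
rewrite mulr0 add0r.
case: ifP => [le_n|/negP gt_n]; last first.
  rewrite big1 // => k _; rewrite big1 // => a sa.
  case: eqVneq => [aw|_]; last by rewrite mulr0.
  case: gt_n; rewrite -aw; apply: (f_compositionK sa _).1.
  by apply/allP => _ /mapP[i _ ->]; exact: ltn_ord.
(* Positive parts give [size w <= sumn w <= n], which puts [size w] in the range of the outer
   sum. *)
have size_w : (size w <= sumn w)%N.
  elim: (w) w_gt0 => //= x v IH /andP[x_gt0 /IH]; lia.
have w_size : (0 < size w)%N by rewrite lt0n size_eq0.
rewrite (bigD1_seq (size w)) ?iota_uniq ?mem_index_iota //=; last by lia.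
rewrite [X in _ + X]big1 ?addr0; last first.
  move=> k /negbTE kw; rewrite big1 // => a _; case: eqVneq => [aw|_].
    by rewrite -aw size_comp size_map size_tuple eqxx in kw.
  by rewrite mulr0.
have [sw wn] := flag_dims_sorted w_gt0 le_n.
have [s sE] := ord_seq wn.
have size_s : size s == size w.
  by rewrite -(size_map val s) sE /flag_dims size_rev size_scanl.
rewrite (bigD1 (Tuple size_s)) /= ?sE // flag_dimsK // eqxx mulr1.
rewrite head_flag_dims // big1 ?addr0 // => a /andP[sa aneq].
case: eqVneq => [aw|_]; last by rewrite mulr0.
case/eqP: aneq; apply/val_inj/(inj_map val_inj); rewrite /= sE.
transitivity (flag_dims n (f_composition n (map val a))); last by rewrite aw.
apply/esym/(f_compositionK sa _).2.
by apply/allP => _ /mapP[i _ ->]; exact: ltn_ord.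
Qed.

End FSeriesCoefficient.

(** * Uniqueness *)

Section CombinatorialTypes.
Variable R : realType.

Lemma lin_ext_gen (A : zmodType) (h : cpolytope R -> A) c : lin_ext h (Pgen c) = h c.
Proof.
by rewrite /lin_ext (msuppU c (1 : int)) oner_eq0 big_seq_fset1 mcoeffUU mulr1z.
Qed.

Lemma cclass_repr (c : cpolytope R) : cclass (tagged (repr c)) = c.
Proof. by rewrite /cclass -[RHS]reprK; case: (repr c). Qed.

Lemma eq_cclass m n (P : polytope R m) (Q : polytope R n) :
  cclass P = cclass Q <->
  comb_equiv_prop (Tagged (polytope R) P) (Tagged (polytope R) Q).
Proof.
by split=> [/eqquotP/asboolP|PQ] //; apply/eqquotP/asboolP.
Qed.

(** The faces of [F] are the faces of [P] contained in [F], so [phi] itself restricts to an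
    equivalence from [F] to [phi F]. *)
Lemma cclass_face m n (P : polytope R m) (Q : polytope R n) phi F :
  set_bij (faces P) (faces Q) phi ->
  {in faces P &, forall F G,
     body F `<=` body G <-> body (phi F) `<=` body (phi G)} ->
  faces P F -> cclass F = cclass (phi F).
Proof.
move=> [phiPQ phi_inj phi_surj] phi_le PF; apply/eq_cclass.
have FP := faces_trans PF.
exists phi; split; first split=> /=.
- move=> G FG; apply: (face_of_sub (phiPQ _ PF) (phiPQ _ (FP _ FG))).
  by apply/(phi_le _ _ _ _).1; rewrite ?inE //; [exact: FP|exact: face_sub].
- by move=> G H /set_mem/FP PG /set_mem/FP PH; apply: phi_inj; rewrite inE.
- move=> G' FG'; have [G PG GE] := phi_surj _ (faces_trans (phiPQ _ PF) FG').
  exists G => //; apply: (face_of_sub PF PG); apply/(phi_le _ _ _ _).2; rewrite ?inE //.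
  by rewrite GE; exact: face_sub.
- by move=> G H /set_mem/FP PG /set_mem/FP PH; apply: phi_le; rewrite inE.
Qed.

(** Supplied later by condition 1 instead of a geometric argument. *)
Hypothesis affdim_cclass : forall m n (P : polytope R m) (Q : polytope R n),
  cclass P = cclass Q -> affdim (body P) = affdim (body Q).

(** Reindexing along [phi] preserves the class of each face, hence its dimension. Thus [d] can be
    computed on any representative. *)
Lemma d_polytope_cclass k m n (P : polytope R m) (Q : polytope R n) :
  cclass P = cclass Q -> d_polytope k P = d_polytope k Q.
Proof.
move=> PQ; have dimPQ := affdim_cclass PQ.
move/eq_cclass: PQ => [/= phi [phi_bij phi_le]].
have cphi F : faces P F -> cclass F = cclass (phi F) := cclass_face phi_bij phi_le.
have dphi F (PF : faces P F) := affdim_cclass (cphi F PF).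
case: phi_bij => phiPQ phi_inj phi_surj.
rewrite /d_polytope [RHS](reindex_fsbig phi
  [set F | faces P F /\ (affdim F + k = affdim P)%N]).
  by apply: eq_fsbigr => F /set_mem[/cphi ->].
split.
- by move=> F [PF dF]; split; [exact: phiPQ|rewrite -dphi // dF].
- move=> F G /set_mem[PF _] /set_mem[PG _]; apply: phi_inj; exact/mem_set.
- move=> G [/phi_surj[F PF <-] dG]; exists F => //; split=> //.
  by rewrite dphi // dG.
Qed.

Lemma d_gen k m (P : polytope R m) : d k (Pgen (cclass P)) = d_polytope k P.
Proof. by rewrite /d lin_ext_gen; apply/d_polytope_cclass/cclass_repr. Qed.

End CombinatorialTypes.

Lemma d_polytope_eq0 (R : realType) k m (P : polytope R m) :
  (affdim (body P) < k)%N -> d_polytope k P = 0.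
Proof.
move=> kP; rewrite /d_polytope (_ : [set F | _] = set0) ?fsbig_set0 //.
by apply/seteqP; split=> // F [_ dF]; lia.
Qed.

Section Uniqueness.
Variables (R : realType) (psi : {additive Pgroup R -> qsym}).
Hypothesis psi_at_zero : forall (m : nat) (P : polytope R m),
  at_zero (psi (Pgen (cclass P))) = 'X^(affdim (body P)).
Hypothesis psi_T : forall p : Pgroup R,
  T (psi p) = \sum_(k \in [set: nat]) mul_t k (psi (d k p)).

(* Condition 1 alone makes the affine dimension a combinatorial invariant: its
   left-hand side depends only on the combinatorial class. *)
Lemma affdim_cclass m n (P : polytope R m) (Q : polytope R n) :
  cclass P = cclass Q -> affdim (body P) = affdim (body Q).
Proof.
move=> PQ; have := psi_at_zero P; rewrite PQ psi_at_zero.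
by move=> /(congr1 (size \o val)) /=; rewrite !size_polyXn => -[].
Qed.

(** Both sides of condition 2 are read at [cons_monom k (compact_monom w)]; on the right only the
    summand of index [k] carries this power of t. *)
Lemma psi_compact_cons m (P : polytope R m) k w :
  qsym_series (psi (Pgen (cclass P))) (compact_monom (k :: w)) =
  \sum_(F <- fset_set [set F | faces P F /\
                        (affdim (body F) + k = affdim (body P))%N])
     qsym_series (psi (Pgen (cclass F))) (compact_monom w).
Proof.
transitivity (qsym_series (psi (d_polytope k P)) (compact_monom w)); last first.
  rewrite /d_polytope fsbig_finite; last first.
    exact: (finite_faces_dim P (fun i => (i + k = affdim (body P))%N)).
  rewrite raddf_sum.
  exact: (big_morph (fun g : qsym => qsym_series g (compact_monom w))).
rewrite -T_cons_monom psi_T.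
(* Beyond the dimension of [P] the summands vanish, so the sum over all naturals is finite; the
   maximum with [k] keeps index [k] in range. *)
set n := (maxn (affdim (body P)) k).+1.
have d0 j : (n <= j)%N -> mul_t j (psi (d j (Pgen (cclass P)))) = 0.
  move=> nj; rewrite (d_gen affdim_cclass) d_polytope_eq0 ?raddf0; last by lia.
  exact: map_monom0.
rewrite -(@fsbig_widen _ _ _ _ `I_n) //; last first.
  by move=> j [_ /= /negP]; rewrite -leqNgt => /d0.
rewrite -fsbig_ord sum_seriesE.
have kn : (k < n)%N by rewrite ltnS leq_maxr.
rewrite (bigD1 (Ordinal kn)) //= big1 ?addr0; last first.
  move=> j /negbTE jk; rewrite mul_t_cons_monom; case: eqVneq => // e.
  by rewrite -val_eqE /= e eqxx in jk.
by rewrite mul_t_cons_monom eqxx (d_gen affdim_cclass).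
Qed.

(** Induction on [w] for all [P] at once, since the recursion passes to faces. The right-hand side
    is that of [f_series_compact]. *)
Lemma psi_compact m (P : polytope R m) w :
  qsym_series (psi (Pgen (cclass P))) (compact_monom w) =
  if (sumn w <= affdim (body P))%N
  then (flag_number P (flag_dims (affdim (body P)) w))%:R *
       'X^(affdim (body P) - sumn w)
  else 0.
Proof.
elim: w m P => [|k w IH] m P.
  rewrite leq0n subn0 flag_number_nil mul1r -psi_at_zero.
  by rewrite /compact_monom /monom big_nil.
rewrite psi_compact_cons /=; set n := affdim (body P).
set Y := [set F | _].
have finY : finite_set Y.
  exact: (finite_faces_dim P (fun i => (i + k = n)%N)).
(* If [k + sumn w] exceeds [n], each face of codimension [k] has dimension below [sumn w], so its
   term is 0 by induction. *)
have [le_n|gt_n] := leqP; last first.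
  rewrite big_seq big1 // => F; rewrite in_fset_set // => /set_mem[_ dF].
  by rewrite IH; case: ifP => //; lia.
have -> : Y = [set F | faces P F /\ affdim (body F) = (n - k)%N].
  by apply/seteqP; split=> F [PF dF]; split=> //; lia.
rewrite flag_dims_cons flag_number_rcons natr_sum mulr_suml big_seq [RHS]big_seq.
apply: eq_bigr => F; rewrite in_fset_set; last first.
  exact: (finite_faces_dim P (fun i => i = n - k)%N).
move=> /set_mem[_ dF]; rewrite IH dF subnDA ifT //; lia.
Qed.

End Uniqueness.

Theorem theorem3 (R : realType) (psi : {additive Pgroup R -> qsym})
  (psi_at_zero : forall (m : nat) (P : polytope R m),
     at_zero (psi (Pgen (cclass P))) = 'X^(affdim (body P)))
  (psi_T : forall p : Pgroup R,
     T (psi p) = \sum_(k \in [set: nat]) mul_t k (psi (d k p))) :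
  forall p : Pgroup R, psi p = f p.
Proof.
(* [f] is defined as an integer combination of its values on generators; additivity expands [psi p]
   likewise, leaving one generator to compare. *)
move=> p; rewrite {1}(monalgE p) raddf_sum /f /lin_ext; apply: eq_bigr => c _.
have -> : << p@_c *g c >> = Pgen c *~ p@_c.
  by rewrite -{1}[p@_c]intz raddfMz.
rewrite raddfMz; congr (_ *~ _); apply: qsym_eq => w w_gt0.
by rewrite -{1}(cclass_repr c) psi_compact // -f_series_compact.
Qed.
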